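(* Let $\theta^0,\theta^\infty_1,\theta^\infty_2,\theta^\infty_3\in\mathbb{C}$ with $\theta^0+\theta^\infty_1+\theta^\infty_2+\theta^\infty_3=0$. Let $q_1,p_1,q_2,p_2,u,v$ be holomorphic functions of $(t_1,t_2)$ on a domain of $\{t_1t_2(t_1-t_2)\neq0\}\subset\mathbb{C}^2$, with $u,v\neq0$. Put $G=\mathrm{diag}(1,u,v)$, $E_2=\mathrm{diag}(0,1,0)$, $E_3=\mathrm{diag}(0,0,1)$, $A_\infty=\mathrm{diag}(0,t_1,t_2)$, $\hat A_0^{(-1)}=\begin{pmatrix}1\\ p_1\\ p_2\end{pmatrix}(-p_1-p_2+1,\,1,\,1)$, and let $\hat A_0^{(0)}=(a_{ij})$ be the $3\times3$ matrix with $$a_{11}=-\theta^\infty_1,\ a_{12}=-q_1,\ a_{13}=-q_2,\quad a_{22}=-\theta^\infty_2,\ a_{33}=-\theta^\infty_3,\quad a_{23}=p_1(q_1-q_2)-\theta^\infty_2,\ a_{32}=p_2(q_2-q_1)-\theta^\infty_3,$$ $$a_{21}=-p_1q_1(p_1+p_2-1)+\theta^\infty_2(p_2-1)+(\theta^\infty_2-\theta^\infty_1)p_1,\quad a_{31}=-p_2q_2(p_1+p_2-1)+\theta^\infty_3(p_1-1)+(\theta^\infty_3-\theta^\infty_1)p_2,$$ $$\hat B_1=\begin{pmatrix}0&\frac{a_{12}}{t_1}&0\\ \frac{a_{21}}{t_1}&0&\frac{a_{23}}{t_1-t_2}\\ 0&\frac{a_{32}}{t_1-t_2}&0\end{pmatrix},\qquad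 \hat B_2=\begin{pmatrix}0&0&\frac{a_{13}}{t_2}\\ 0&0&\frac{a_{23}}{t_2-t_1}\\ \frac{a_{31}}{t_2}&\frac{a_{32}}{t_2-t_1}&0\end{pmatrix}.$$ Consider the linear systems $\frac{\partial Y}{\partial x}=AY$, $\frac{\partial Y}{\partial t_i}=B^{(i)}Y$ $(i=1,2)$ with $$A=G^{-1}\left(\frac{\hat A_0^{(-1)}}{x^2}+\frac{\hat A_0^{(0)}}{x}\right)G+A_\infty,\quad B^{(1)}=E_2x+G^{-1}\hat B_1G,\quad B^{(2)}=E_3x+G^{-1}\hat B_2G .$$ Then the compatibility conditions $\partial_{t_i}A-\partial_xB^{(i)}+[A,B^{(i)}]=O$ for $i=1,2$ (for all $x$) are equivalent to the Hamiltonian system $$\frac{\partial q_j}{\partial t_i}=\frac{\partial H_{t_i}}{\partial p_j},\qquad \frac{\partial p_j}{\partial t_i}=-\frac{\partial H_{t_i}}{\partial q_j}\qquad(i,j=1,2),$$ $$t_1H_{t_1}=t_1H_{\mathrm{III}}(D_6)(-\theta^\infty_2,\theta^\infty_1-\theta^\infty_2;t_1;q_1,p_1)+q_1(q_1p_1p_2-\theta^\infty_2p_2)+\frac{t_1}{t_1-t_2}(p_1(q_1-q_2)-\theta^\infty_2)(p_2(q_2-q_1)-\theta^\infty_3),$$ $$t_2H_{t_2}=t_2H_{\mathrm{III}}(D_6)(-\theta^\infty_3,\theta^\infty_1-\theta^\infty_3;t_2;q_2,p_2)+q_2(q_2p_1p_2-\theta^\infty_3p_1)+\frac{t_2}{t_2-t_1}(p_1(q_1-q_2)-\theta^\infty_2)(p_2(q_2-q_1)-\theta^\infty_3),$$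 together with $$t_1(t_1-t_2)\frac1u\frac{\partial u}{\partial t_1}=(t_1-t_2)(1-2p_1)q_1+p_2(t_2q_1-t_1q_2)+\theta^\infty_3t_1,\quad t_1(t_1-t_2)\frac1v\frac{\partial v}{\partial t_1}=t_1(\theta^\infty_2-2p_1q_1)+p_1(t_2q_1+t_1q_2),$$ $$t_2(t_2-t_1)\frac1u\frac{\partial u}{\partial t_2}=t_2(\theta^\infty_3-2p_2q_2)+p_2(t_2q_1+t_1q_2),\quad t_2(t_2-t_1)\frac1v\frac{\partial v}{\partial t_2}=(t_2-t_1)(1-2p_2)q_2+p_1(t_1q_2-t_2q_1)+\theta^\infty_2t_2 .$$
   Context: $tH_{\mathrm{III}}(D_6)(\alpha,\beta;t;q,p)=p^2q^2-(q^2-\beta q-t)p-\alpha q$ defines the Hamiltonian of the third Painlevé equation of type $D_6$. The Hamiltonians are those of the degenerate Garnier system $H_{\mathrm{Gar}}^{\frac32+1+1+1}$, here attached to an unramified rank-three linear system of spectral type $(2)(1),(1)(1)(1)$. *)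

(* Defs.v *)
From HB Require Import structures.
From mathcomp Require Import all_boot all_order all_algebra.
From mathcomp Require Import complex.
From mathcomp Require Import all_classical all_reals all_analysis.

Set Implicit Arguments.
Unset Strict Implicit.
Unset Printing Implicit Defensive.

Import Order.TTheory GRing.Theory Num.Theory.
Import numFieldNormedType.Exports.

Local Open Scope classical_set_scope.
Local Open Scope ring_scope.

(* K is instantiated with the complex numbers R[i] over R : realType. Stating
   the definitions for K makes R[i] carry the topology of its norm, and makes
   `differentiable`, `'D_v f` and `derive1` complex-analytic notions. A point of
   K * K is t = (t_1, t_2). *)
Section Defs.
Variable K : numClosedFieldType.
Implicit Types (D : set (K * K)) (x al be : K) (t : K * K).

Definition is_domain D : Prop := [/\ open D, connected D & D !=set0].

Definition holomorphic_on D (f : K * K -> K) : Prop :=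
  forall t, D t -> differentiable f t.

Definition partial1 (W : normedModType K) (f : K * K -> W) t : W :=
  'D_((1, 0) : K * K) f t.

Definition partial2 (W : normedModType K) (f : K * K -> W) t : W :=
  'D_((0, 1) : K * K) f t.

Definition mx3 (rows : seq (seq K)) : 'M[K]_3 :=
  \matrix_(i, j) (nth [::] rows i)`_j.

Definition row3 (a b c : K) : 'rV[K]_3 := \row_j [:: a; b; c]`_j.

Definition diag3 (a b c : K) : 'M[K]_3 := diag_mx (row3 a b c).

Definition E2 : 'M[K]_3 := diag3 0 1 0.
Definition E3 : 'M[K]_3 := diag3 0 0 1.

(* th1, th2, th3 are theta^infty_1, theta^infty_2, theta^infty_3. *)
Section LaxPair.
Variables th1 th2 th3 : K.

Definition hatAm1 (p1 p2 : K) : 'M[K]_3 :=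
  (row3 1 p1 p2)^T *m row3 (- p1 - p2 + 1) 1 1.

Definition hatA0 (q1 p1 q2 p2 : K) : 'M[K]_3 :=
  mx3 [:: [:: - th1; - q1; - q2];
          [:: - (p1 * q1 * (p1 + p2 - 1)) + th2 * (p2 - 1) + (th2 - th1) * p1;
              - th2;
              p1 * (q1 - q2) - th2];
          [:: - (p2 * q2 * (p1 + p2 - 1)) + th3 * (p1 - 1) + (th3 - th1) * p2;
              p2 * (q2 - q1) - th3;
              - th3]].

(* The indices of 'I_3 start at 0: a 0 1 is a_{12}. *)
Definition hatB1 t (a : 'M[K]_3) : 'M[K]_3 :=
  mx3 [:: [:: 0;              a 0 1 / t.1;            0];
          [:: a 1 0 / t.1;    0;                      a 1 2 / (t.1 - t.2)];
          [:: 0;              a 2 1 / (t.1 - t.2);    0]].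

Definition hatB2 t (a : 'M[K]_3) : 'M[K]_3 :=
  mx3 [:: [:: 0;              0;                      a 0 2 / t.2];
          [:: 0;              0;                      a 1 2 / (t.2 - t.1)];
          [:: a 2 0 / t.2;    a 2 1 / (t.2 - t.1);    0]].

Variables q1 p1 q2 p2 u v : K * K -> K.

Definition gauge t : 'M[K]_3 := diag3 1 (u t) (v t).

Definition A0 t : 'M[K]_3 := hatA0 (q1 t) (p1 t) (q2 t) (p2 t).

Definition laxA x t : 'M[K]_3 :=
  invmx (gauge t) *m
    ((x ^+ 2)^-1 *: hatAm1 (p1 t) (p2 t) + x^-1 *: A0 t) *m gauge t
  + diag3 0 t.1 t.2.

Definition laxB1 x t : 'M[K]_3 :=
  x *: E2 + invmx (gauge t) *m hatB1 t (A0 t) *m gauge t.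

Definition laxB2 x t : 'M[K]_3 :=
  x *: E3 + invmx (gauge t) *m hatB2 t (A0 t) *m gauge t.

Definition compatible1 x t : Prop :=
  partial1 (laxA x) t - derive1 (fun y : K => laxB1 y t) x
  + (laxA x t *m laxB1 x t - laxB1 x t *m laxA x t) = 0.

Definition compatible2 x t : Prop :=
  partial2 (laxA x) t - derive1 (fun y : K => laxB2 y t) x
  + (laxA x t *m laxB2 x t - laxB2 x t *m laxA x t) = 0.

End LaxPair.

Definition H_III_D6 al be (s q p : K) : K :=
  (p ^+ 2 * q ^+ 2 - (q ^+ 2 - be * q - s) * p - al * q) / s.

Section Hamiltonians.
Variables th1 th2 th3 : K.

Definition H1 t (q1 p1 q2 p2 : K) : K :=
  (t.1 * H_III_D6 (- th2) (th1 - th2) t.1 q1 p1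
   + q1 * (q1 * p1 * p2 - th2 * p2)
   + t.1 / (t.1 - t.2)
     * (p1 * (q1 - q2) - th2) * (p2 * (q2 - q1) - th3)) / t.1.

Definition H2 t (q1 p1 q2 p2 : K) : K :=
  (t.2 * H_III_D6 (- th3) (th1 - th3) t.2 q2 p2
   + q2 * (q2 * p1 * p2 - th3 * p1)
   + t.2 / (t.2 - t.1)
     * (p1 * (q1 - q2) - th2) * (p2 * (q2 - q1) - th3)) / t.2.

End Hamiltonians.

(* Hamilton's equations at t for one of the two times: d is the partial
   derivative in that time and H, with arguments t, q_1, p_1, q_2, p_2, is the
   corresponding Hamiltonian. *)
Definition hamilton_eqs (d : (K * K -> K) -> K * K -> K)
    (H : K * K -> K -> K -> K -> K -> K) (q1 p1 q2 p2 : K * K -> K) t : Prop :=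
  [/\ d q1 t = derive1 (fun p : K => H t (q1 t) p (q2 t) (p2 t)) (p1 t),
      d q2 t = derive1 (fun p : K => H t (q1 t) (p1 t) (q2 t) p) (p2 t),
      d p1 t = - derive1 (fun q : K => H t q (p1 t) (q2 t) (p2 t)) (q1 t) &
      d p2 t = - derive1 (fun q : K => H t (q1 t) (p1 t) q (p2 t)) (q2 t)].

Section GaugeEquations.
Variables (th2 th3 : K) (q1 p1 q2 p2 u v : K * K -> K).

Definition gauge_eqs1 t : Prop :=
  t.1 * (t.1 - t.2) * (u t)^-1 * partial1 u t =
    (t.1 - t.2) * (1 - 2 * p1 t) * q1 t
    + p2 t * (t.2 * q1 t - t.1 * q2 t) + th3 * t.1
  /\
  t.1 * (t.1 - t.2) * (v t)^-1 * partial1 v t =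
    t.1 * (th2 - 2 * p1 t * q1 t) + p1 t * (t.2 * q1 t + t.1 * q2 t).

Definition gauge_eqs2 t : Prop :=
  t.2 * (t.2 - t.1) * (u t)^-1 * partial2 u t =
    t.2 * (th3 - 2 * p2 t * q2 t) + p2 t * (t.2 * q1 t + t.1 * q2 t)
  /\
  t.2 * (t.2 - t.1) * (v t)^-1 * partial2 v t =
    (t.2 - t.1) * (1 - 2 * p2 t) * q2 t
    + p1 t * (t.1 * q2 t - t.2 * q1 t) + th2 * t.2.

End GaugeEquations.

End Defs.

(* Main.v *)
Require Import Defs.
From HB Require Import structures.
From mathcomp Require Import all_boot all_order all_algebra.
From mathcomp Require Import complex ring.
From mathcomp Require Import all_classical all_reals all_analysis.

Import Order.TTheory GRing.Theory Num.Theory.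
Import numFieldNormedType.Exports.

Local Open Scope classical_set_scope.
Local Open Scope ring_scope.
Local Open Scope complex_scope.

(**
Write the gauge-free form of the connection, A = G^-1 (x^-2 P + x^-1 Q) G + T
and B = x E + G^-1 b G, where P and Q are the coefficient matrices before
conjugation, T = diag (0, t_1, t_2), E is the derivative of T in the time
considered and b is the gauge-free part of B.  Since G, T and E are diagonal
and commute, the zero curvature equation is conjugate under G to

  x^-2 (P' + [P, Om + b]) + x^-1 (Q' + [Q, Om + b] + [P, E])
    + ([Q, E] + [T, b]) = 0,

where a prime is the derivative in the time and Om = G' G^-1 (lemma
[curvature_gauged]).  The matrix b is made so that the constant term vanishes
([curv0_hatB1], [curv0_hatB2]), and the values x = 1 and x = -1 separate the
two remaining coefficients, called [curv2] and [curv1] below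
([zero_curvatureP]).

At a fixed time these coefficients are affine functions of the six unknown
velocities q_j', p_j', u'/u, v'/v.  Their linear part is injective
([curv_injective0]): the first row of the x^-2 coefficient gives u'/u and v'/v,
its diagonal p_1' and p_2', and the first row of the x^-1 coefficient q_1' and
q_2'.  So at most one velocity is flat.  That the Hamiltonian velocity, together
with the prescribed u'/u and v'/v, is flat is a finite computation with rational
functions ([curv_flow1P], [curv_flow2P]).  Hence compatibility says exactly that
the velocity of the solution is the Hamiltonian one.
*)

Set Implicit Arguments.
Unset Strict Implicit.
Unset Printing Implicit Defensive.

(** * Derivatives of scalar and matrix functions *)

Section ScalarRules.
Context {K : numFieldType} {V : normedModType K}.
Implicit Types (f g : V -> K) (t w : V) (a b : K).

(** The difference quotient is constant.  This gives the derivatives of the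
    coordinates of a product. *)
Lemma is_derive_affine f t w a :
  (forall h, f (h *: w + t) = h * a + f t) -> is_derive t w f a.
Proof.
move=> fE.
have quotient : h^-1 *: ((f \o shift t) (h *: w) - f t) @[h --> 0^'] --> a.
  apply: cvg_near_cst; near=> h.
  have h0 : h != 0 by near: h; exact: nbhs_dnbhs_neq.
  by rewrite /= fE addrK [LHS]mulrA mulVf ?mul1r.
by split; [exact: cvgP quotient | exact: cvg_lim quotient].
Unshelve. all: by end_near. Qed.

Lemma is_deriveD_fun f g t w a b :
  is_derive t w f a -> is_derive t w g b ->
  is_derive t w (fun s => f s + g s) (a + b).
Proof. by move=> fa gb; exact: (is_deriveD fa gb). Qed.

Lemma is_deriveN_fun f t w a :
  is_derive t w f a -> is_derive t w (fun s => - f s) (- a).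
Proof. by move=> fa; exact: (is_deriveN fa). Qed.

Lemma is_deriveM_fun f g t w a b :
  is_derive t w f a -> is_derive t w g b ->
  is_derive t w (fun s => f s * g s) (a * g t + f t * b).
Proof.
move=> fa gb; have -> : a * g t + f t * b = f t *: b + g t *: a.
  by rewrite addrC [a * _]mulrC.
exact: (is_deriveM fa gb).
Qed.

Lemma is_deriveX2_fun f t w a :
  is_derive t w f a -> is_derive t w (fun s => f s ^+ 2) (2 * f t * a).
Proof.
move=> fa; have -> : 2 * f t * a = a * f t + f t * a by ring.
exact: (is_deriveM_fun fa fa).
Qed.

Lemma is_deriveV_fun f t w a : f t != 0 ->
  is_derive t w f a -> is_derive t w (fun s => (f s)^-1) (- (a / f t) / f t).
Proof.
move=> ft0 fa; split; first exact: derivableV.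
by rewrite deriveV// derive_val [LHS]mulNr; field.
Qed.

Lemma is_derive_sum_fun n (f : 'I_n -> V -> K) t w (a : 'I_n -> K) :
  (forall i, is_derive t w (f i) (a i)) ->
  is_derive t w (fun s => \sum_(i < n) f i s) (\sum_(i < n) a i).
Proof.
move=> fa; suff -> : (fun s => \sum_(i < n) f i s) = \sum_(i < n) f i.
  exact: is_derive_sum.
by apply/funext => s; rewrite fct_sumE.
Qed.

Lemma is_derive_cst_fun a t w : is_derive t w (fun _ : V => a) 0.
Proof. exact: is_derive_cst. Qed.

End ScalarRules.

(* Differentiates a polynomial expression in functions whose derivatives are in
   the context.  Instance resolution is kept out of it: it would also find the
   derivatives, but with products in the form of scalings, on which [ring] and
   [field] fail. *)
Ltac derive_scalar :=
  notypeclasses refine (is_derive_eq _ _);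
  [ repeat first [ eassumption
                 | notypeclasses refine (is_derive_cst_fun _ _ _)
                 | notypeclasses refine (is_derive_id _ _)
                 | notypeclasses refine (is_deriveD_fun _ _)
                 | notypeclasses refine (is_deriveN_fun _)
                 | notypeclasses refine (is_deriveX2_fun _)
                 | notypeclasses refine (is_deriveM_fun _ _) ]
  | cbv beta ].

Section MatrixRules.
Context {K : numFieldType} {V : normedModType K}.

(** Entrywise form of [is_derive], in which the product rule reduces to the
    scalar one. *)
Definition is_derive_entries m n (M : V -> 'M[K]_(m, n)) t w (dM : 'M[K]_(m, n)) :=
  forall i j, is_derive t w (fun s => M s i j) (dM i j).

(** A matrix is the sum of its entries times the matrix units, so convergence of
    the entries of the difference quotient gives convergence of the quotient. *)
Lemma is_derive_mx m n (M : V -> 'M[K]_(m, n)) t w dM :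
  is_derive_entries M t w dM -> is_derive t w M dM.
Proof.
move=> MdM.
have quotient :
    h^-1 *: ((M \o shift t) (h *: w) - M t) @[h --> 0^'] --> dM.
  rewrite [dM]matrix_sum_delta.
  under eq_cvg do rewrite [_ *: _]matrix_sum_delta.
  apply: cvg_big => [|i _]; first exact: add_continuous.
  apply: cvg_big => [|j _]; first exact: add_continuous.
  apply: cvgZr_tmp; under eq_cvg do rewrite !mxE.
  have [Mij <-] := MdM i j; exact: Mij.
by split; [exact: cvgP quotient | exact: cvg_lim quotient].
Qed.

Lemma is_derive_entriesD m n (M N : V -> 'M[K]_(m, n)) t w dM dN :
  is_derive_entries M t w dM -> is_derive_entries N t w dN ->
  is_derive_entries (fun s => M s + N s) t w (dM + dN).
Proof.
move=> Md Nd i j; rewrite mxE; under eq_fun do rewrite mxE.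
exact: is_deriveD_fun.
Qed.

Lemma is_derive_entriesZ m n (M : V -> 'M[K]_(m, n)) t w dM a :
  is_derive_entries M t w dM ->
  is_derive_entries (fun s => a *: M s) t w (a *: dM).
Proof.
move=> Md i j; rewrite mxE; under eq_fun do rewrite mxE.
exact: (is_deriveZ a (Md i j)).
Qed.

Lemma is_derive_entriesM m n p (M : V -> 'M[K]_(m, n)) (N : V -> 'M[K]_(n, p))
    t w dM dN :
  is_derive_entries M t w dM -> is_derive_entries N t w dN ->
  is_derive_entries (fun s => M s *m N s) t w (dM *m N t + M t *m dN).
Proof.
move=> Md Nd i j; rewrite !mxE -big_split/=; under eq_fun do rewrite mxE.
by apply: is_derive_sum_fun => k; exact: is_deriveM_fun.
Qed.

End MatrixRules.

(** * Commutators of three by three matrices *)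

Section MatrixCalculus.
Context {K : numClosedFieldType}.
Implicit Types (a b c d : K) (X Y Z M : 'M[K]_3).

Definition mat3 a b c a' b' c' a'' b'' c'' : 'M[K]_3 :=
  mx3 [:: [:: a; b; c]; [:: a'; b'; c']; [:: a''; b''; c'']].

Definition comm X Y := X *m Y - Y *m X.

Lemma ord3P (k : 'I_3) : [\/ k = 0, k = 1 | k = 2].
Proof.
by case: k => [[|[|[|//]]] ?];
  [constructor 1|constructor 2|constructor 3]; exact: val_inj.
Qed.

Lemma mat3P M a b c a' b' c' a'' b'' c'' :
  M 0 0 = a -> M 0 1 = b -> M 0 2 = c ->
  M 1 0 = a' -> M 1 1 = b' -> M 1 2 = c' ->
  M 2 0 = a'' -> M 2 1 = b'' -> M 2 2 = c'' ->
  M = mat3 a b c a' b' c' a'' b'' c''.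
Proof.
move=> *; apply/matrixP => i j.
by case: (ord3P i) => ->; case: (ord3P j) => ->; rewrite mxE.
Qed.

Lemma mat3D a b c a' b' c' a'' b'' c'' x y z x' y' z' x'' y'' z'' :
  mat3 a b c a' b' c' a'' b'' c'' + mat3 x y z x' y' z' x'' y'' z'' =
  mat3 (a + x) (b + y) (c + z) (a' + x') (b' + y') (c' + z')
       (a'' + x'') (b'' + y'') (c'' + z'').
Proof. by apply: mat3P; rewrite !mxE. Qed.

Lemma mat3N a b c a' b' c' a'' b'' c'' :
  - mat3 a b c a' b' c' a'' b'' c'' =
  mat3 (- a) (- b) (- c) (- a') (- b') (- c') (- a'') (- b'') (- c'').
Proof. by apply: mat3P; rewrite !mxE. Qed.

Lemma mat3M a b c a' b' c' a'' b'' c'' x y z x' y' z' x'' y'' z'' :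
  mat3 a b c a' b' c' a'' b'' c'' *m mat3 x y z x' y' z' x'' y'' z'' =
  mat3 (a * x + b * x' + c * x'') (a * y + b * y' + c * y'')
       (a * z + b * z' + c * z'')
       (a' * x + b' * x' + c' * x'') (a' * y + b' * y' + c' * y'')
       (a' * z + b' * z' + c' * z'')
       (a'' * x + b'' * x' + c'' * x'') (a'' * y + b'' * y' + c'' * y'')
       (a'' * z + b'' * z' + c'' * z'').
Proof. by apply: mat3P; rewrite mxE !big_ord_recl big_ord0 !mxE /= addr0 addrA. Qed.

Lemma mat3_0 : 0 = mat3 0 0 0 0 0 0 0 0 0.
Proof. by apply: mat3P; rewrite mxE. Qed.

Lemma diag3E a b c : diag3 a b c = mat3 a 0 0 0 b 0 0 0 c.
Proof. by apply: mat3P; rewrite !mxE. Qed.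

Lemma row3_mulE a b c x y z : (row3 a b c)^T *m row3 x y z =
  mat3 (a * x) (a * y) (a * z) (b * x) (b * y) (b * z) (c * x) (c * y) (c * z).
Proof. by apply: mat3P; rewrite mxE big_ord_recl big_ord0 !mxE addr0. Qed.

Lemma diag3C a b c x y z : comm (diag3 a b c) (diag3 x y z) = 0.
Proof. by rewrite /comm !diag3E !(mat3M, mat3N, mat3D) mat3_0; congr mat3; ring. Qed.

Lemma commDl X Y Z : comm (X + Y) Z = comm X Z + comm Y Z.
Proof. by rewrite /comm mulmxDl mulmxDr opprD addrACA. Qed.

Lemma commDr X Y Z : comm X (Y + Z) = comm X Y + comm X Z.
Proof. by rewrite /comm mulmxDl mulmxDr opprD addrACA. Qed.

Lemma commZl a X Y : comm (a *: X) Y = a *: comm X Y.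
Proof. by rewrite /comm -scalemxAl -scalemxAr scalerBr. Qed.

Lemma commZr a X Y : comm X (a *: Y) = a *: comm X Y.
Proof. by rewrite /comm -scalemxAl -scalemxAr scalerBr. Qed.

Lemma commNr X Y : comm X (- Y) = - comm X Y.
Proof. by rewrite /comm mulmxN mulNmx -opprB opprK addrC opprB. Qed.

Lemma commr0 X : comm X 0 = 0.
Proof. by rewrite /comm mulmx0 mul0mx subr0. Qed.

Lemma comm_conj M X Y : M \in unitmx ->
  comm (invmx M *m X *m M) (invmx M *m Y *m M) = invmx M *m comm X Y *m M.
Proof.
move=> uM; have conjM Z Z' : invmx M *m Z *m M *m (invmx M *m Z' *m M) =
    invmx M *m (Z *m Z') *m M.
  by rewrite !mulmxA mulmxK.
by rewrite /comm !conjM mulmxBr mulmxBl.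
Qed.

Lemma conj_commute M X : M \in unitmx -> comm X M = 0 ->
  invmx M *m X *m M = X.
Proof. by move=> uM /subr0_eq XM; rewrite -mulmxA XM mulKmx. Qed.

Lemma conj_eq0 M X : M \in unitmx -> (invmx M *m X *m M == 0) = (X == 0).
Proof.
move=> uM; apply/eqP/eqP => [eq0|->]; last by rewrite mulmx0 mul0mx.
have : M *m (invmx M *m X *m M) *m invmx M = 0 by rewrite eq0 mulmx0 mul0mx.
by rewrite !mulmxA mulmxV// mul1mx mulmxK.
Qed.

Lemma diag3N a b c : - diag3 a b c = diag3 (- a) (- b) (- c).
Proof. by rewrite !diag3E mat3N oppr0. Qed.

Lemma mul_diag3 a b c x y z :
  diag3 a b c *m diag3 x y z = diag3 (a * x) (b * y) (c * z).
Proof. by rewrite !diag3E mat3M; congr mat3; ring. Qed.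

Lemma diag3_1 : diag3 1 1 1 = 1%:M :> 'M[K]_3.
Proof. by rewrite diag3E; apply/esym/mat3P; rewrite mxE. Qed.

Lemma diag3_unit b c : b != 0 -> c != 0 -> diag3 1 b c \in unitmx.
Proof.
move=> b0 c0; apply: (proj1 (@mulmx1_unit _ _ _ (diag3 1 b^-1 c^-1) _)).
by rewrite mul_diag3 mul1r !mulfV// diag3_1.
Qed.

Lemma invmx_diag3 b c : b != 0 -> c != 0 ->
  invmx (diag3 1 b c) = diag3 1 b^-1 c^-1.
Proof.
move=> b0 c0; apply: (can_inj (mulmxK (diag3_unit b0 c0))).
by rewrite mulVmx ?diag3_unit// mul_diag3 mul1r !mulVf// diag3_1.
Qed.

End MatrixCalculus.

(** * Flat velocities *)

(** The unknowns of the compatibility equations at a given time: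
    q_1', p_1', q_2', p_2', u'/u, v'/v. *)
Record velocity (K : Type) := Velocity {
  vq1 : K; vp1 : K; vq2 : K; vp2 : K; vlogu : K; vlogv : K }.

Section Flow.
Context {K : numClosedFieldType}.

Definition velocityB (X Y : velocity K) : velocity K :=
  Velocity (vq1 X - vq1 Y) (vp1 X - vp1 Y) (vq2 X - vq2 Y) (vp2 X - vp2 Y)
           (vlogu X - vlogu Y) (vlogv X - vlogv Y).

Lemma velocityB_eq (X Y : velocity K) :
  velocityB X Y = Velocity 0 0 0 0 0 0 -> X = Y.
Proof.
by case: X Y => [? ? ? ? ? ?] [? ? ? ? ? ?] [];
  do 6 move=> /subr0_eq ->.
Qed.

Section Curvature.
Variables th1 th2 th3 q1 p1 q2 p2 : K.

(** Differentials of [hatAm1 p1 p2] and [hatA0 th1 th2 th3 q1 p1 q2 p2] applied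
    to the velocity [X]. *)
Definition dhatAm1 (X : velocity K) : 'M[K]_3 :=
  (row3 0 (vp1 X) (vp2 X))^T *m row3 (- p1 - p2 + 1) 1 1
  + (row3 1 p1 p2)^T *m row3 (- vp1 X - vp2 X) 0 0.

Definition dhatA0 (X : velocity K) : 'M[K]_3 :=
  mat3 0 (- vq1 X) (- vq2 X)
    (- ((vp1 X * q1 + p1 * vq1 X) * (p1 + p2 - 1)
        + p1 * q1 * (vp1 X + vp2 X))
     + th2 * vp2 X + (th2 - th1) * vp1 X)
    0
    (vp1 X * (q1 - q2) + p1 * (vq1 X - vq2 X))
    (- ((vp2 X * q2 + p2 * vq2 X) * (p1 + p2 - 1)
        + p2 * q2 * (vp1 X + vp2 X))
     + th3 * vp1 X + (th3 - th1) * vp2 X)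
    (vp2 X * (q2 - q1) + p2 * (vq2 X - vq1 X))
    0.

(** G' G^-1 for the gauge matrix G = diag (1, u, v). *)
Definition dloggauge (X : velocity K) : 'M[K]_3 := diag3 0 (vlogu X) (vlogv X).

(** Coefficients of x^-2 and x^-1 in the curvature, up to conjugation by the
    gauge.  Their dependence on [X] is affine; [E] and [B] occur only in the
    terms without [X], so the linear parts are [curv2 0] and [curv1 0 0]. *)
Definition curv2 (B : 'M[K]_3) (X : velocity K) : 'M[K]_3 :=
  dhatAm1 X + comm (hatAm1 p1 p2) (dloggauge X + B).

Definition curv1 (E B : 'M[K]_3) (X : velocity K) : 'M[K]_3 :=
  dhatA0 X + comm (hatA0 th1 th2 th3 q1 p1 q2 p2) (dloggauge X + B)
  + comm (hatAm1 p1 p2) E.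

Let dloggaugeB X Y : dloggauge (velocityB X Y) = dloggauge X - dloggauge Y.
Proof. by rewrite /dloggauge !diag3E mat3N mat3D; congr mat3 => /=; ring. Qed.

Lemma curv2B B X Y : curv2 B X - curv2 B Y = curv2 0 (velocityB X Y).
Proof.
have dB : dhatAm1 (velocityB X Y) = dhatAm1 X - dhatAm1 Y.
  by rewrite /dhatAm1 !row3_mulE !(mat3N, mat3D); congr mat3 => /=; ring.
rewrite /curv2 dB dloggaugeB !commDr commNr commr0.
by apply/matrixP => i j; rewrite !mxE; ring.
Qed.

Lemma curv1B E B X Y : curv1 E B X - curv1 E B Y = curv1 0 0 (velocityB X Y).
Proof.
have dB : dhatA0 (velocityB X Y) = dhatA0 X - dhatA0 Y.
  by rewrite /dhatA0 !(mat3N, mat3D); congr mat3 => /=; ring.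
rewrite /curv1 dB dloggaugeB !commDr commNr !commr0.
by apply/matrixP => i j; rewrite !mxE; ring.
Qed.

(** The six velocities can be read off one after the other, each time from an
    entry in which only one velocity not yet determined occurs. *)
Lemma curv_injective0 X :
  curv2 0 X = 0 -> curv1 0 0 X = 0 -> X = Velocity 0 0 0 0 0 0.
Proof.
rewrite /curv2 /curv1 !commr0 !addr0.
rewrite /comm /dhatAm1 /dhatA0 /dloggauge /hatAm1 /hatA0 !row3_mulE diag3E.
rewrite -!/(mat3 _ _ _ _ _ _ _ _ _) !(mat3D, mat3M, mat3N).
case: X => xq1 xp1 xq2 xp2 xu xv /= /matrixP C2 /matrixP C1.
have u0 : xu = 0 by have := C2 0 1; rewrite !mxE /= => <-; ring.
have v0 : xv = 0 by have := C2 0 2; rewrite !mxE /= => <-; ring.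
have p10 : xp1 = 0 by have := C2 1 1; rewrite !mxE /= => <-; ring.
have p20 : xp2 = 0 by have := C2 2 2; rewrite !mxE /= => <-; ring.
have := C1 0 1; rewrite !mxE /= u0 => q10.
have := C1 0 2; rewrite !mxE /= v0 => q20.
congr Velocity => //.
  by apply: oppr_inj; rewrite oppr0 -[RHS]q10; ring.
by apply: oppr_inj; rewrite oppr0 -[RHS]q20; ring.
Qed.

(** Two flat velocities differ by an element of the kernel of the linear part. *)
Lemma curv_eq0P E B X Y : curv2 B Y = 0 -> curv1 E B Y = 0 ->
  (curv2 B X = 0 /\ curv1 E B X = 0) <-> X = Y.
Proof.
move=> C2Y C1Y; split=> [[C2X C1X]|->//]; apply/velocityB_eq/curv_injective0.
  by rewrite -(curv2B B) C2X C2Y subr0.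
by rewrite -(curv1B E B) C1X C1Y subr0.
Qed.

End Curvature.

(** The exchange of the indices 1 and 2 of t, q, p together with that of th2 and
    th3, and of u and v, turns the first flow into the second.  So each formula is
    given once, for a flow with time [s] whose own canonical pair is (q1, p1); the
    other time is [r] and the other pair (q2, p2). *)
Section HamiltonianFlow.
Variables th1 th2 th3 s r q1 p1 q2 p2 : K.

Definition dH_own_p :=
  (2 * p1 * q1 ^+ 2 - (q1 ^+ 2 - (th1 - th2) * q1 - s) + q1 ^+ 2 * p2) / s
  + (q1 - q2) * (p2 * (q2 - q1) - th3) / (s - r).

Definition dH_own_q :=
  (2 * p1 ^+ 2 * q1 - (2 * q1 - (th1 - th2)) * p1 + th2
   + 2 * q1 * p1 * p2 - th2 * p2) / s
  + (p1 * (p2 * (q2 - q1) - th3) - p2 * (p1 * (q1 - q2) - th2)) / (s - r).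

Definition dH_other_p :=
  (q1 ^+ 2 * p1 - th2 * q1) / s
  + (p1 * (q1 - q2) - th2) * (q2 - q1) / (s - r).

Definition dH_other_q :=
  - (p1 * (p2 * (q2 - q1) - th3) - p2 * (p1 * (q1 - q2) - th2)) / (s - r).

Definition dlog_own :=
  ((s - r) * (1 - 2 * p1) * q1 + p2 * (r * q1 - s * q2) + th3 * s)
  / (s * (s - r)).

Definition dlog_other :=
  (s * (th2 - 2 * p1 * q1) + p1 * (r * q1 + s * q2)) / (s * (s - r)).

End HamiltonianFlow.

Definition flow1 th1 th2 th3 (t : K * K) q1 p1 q2 p2 : velocity K := Velocity
  (dH_own_p th1 th2 th3 t.1 t.2 q1 p1 q2 p2)
  (- dH_own_q th1 th2 th3 t.1 t.2 q1 p1 q2 p2)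
  (dH_other_p th2 t.1 t.2 q1 p1 q2)
  (- dH_other_q th2 th3 t.1 t.2 q1 p1 q2 p2)
  (dlog_own th3 t.1 t.2 q1 p1 q2 p2)
  (dlog_other th2 t.1 t.2 q1 p1 q2).

Definition flow2 th1 th2 th3 (t : K * K) q1 p1 q2 p2 : velocity K := Velocity
  (dH_other_p th3 t.2 t.1 q2 p2 q1)
  (- dH_other_q th3 th2 t.2 t.1 q2 p2 q1 p1)
  (dH_own_p th1 th3 th2 t.2 t.1 q2 p2 q1 p1)
  (- dH_own_q th1 th3 th2 t.2 t.1 q2 p2 q1 p1)
  (dlog_other th3 t.2 t.1 q2 p2 q1)
  (dlog_own th2 t.2 t.1 q2 p2 q1 p1).

Section FlowIsFlat.
Variables (th1 th2 th3 : K) (t : K * K) (q1 p1 q2 p2 : K).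
Hypotheses (t1n0 : t.1 != 0) (t2n0 : t.2 != 0) (t12n0 : t.1 - t.2 != 0).

Let t21n0 : t.2 - t.1 != 0. Proof. by rewrite -opprB oppr_eq0. Qed.

Let A0 := hatA0 th1 th2 th3 q1 p1 q2 p2.

Ltac flat_entries :=
  rewrite /curv2 /curv1 /dhatAm1 /dhatA0 /dloggauge /comm /hatAm1 /E2 /E3;
  rewrite /hatB1 /hatB2 ?row3_mulE ?diag3E ?[A0 _ _]mxE /= /A0 /hatA0;
  rewrite -?/(mat3 _ _ _ _ _ _ _ _ _) ?(mat3D, mat3M, mat3N) mat3_0;
  rewrite /flow1 /flow2 /= /dH_own_p /dH_own_q /dH_other_p /dH_other_q;
  rewrite /dlog_own /dlog_other;
  congr mat3; field; rewrite ?t1n0 ?t2n0 ?t12n0 ?t21n0 //.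

(** The heart of the matter: the Hamiltonian velocity is flat, hence the only
    flat one. *)
Lemma curv_flow1P X :
  (curv2 p1 p2 (hatB1 t A0) X = 0 /\
   curv1 th1 th2 th3 q1 p1 q2 p2 (E2 K) (hatB1 t A0) X = 0)
  <-> X = flow1 th1 th2 th3 t q1 p1 q2 p2.
Proof. by apply: curv_eq0P; flat_entries. Qed.

Lemma curv_flow2P X :
  (curv2 p1 p2 (hatB2 t A0) X = 0 /\
   curv1 th1 th2 th3 q1 p1 q2 p2 (E3 K) (hatB2 t A0) X = 0)
  <-> X = flow2 th1 th2 th3 t q1 p1 q2 p2.
Proof. by apply: curv_eq0P; flat_entries. Qed.

(** The coefficient of x^0 in the curvature contains no velocity: [hatB1] and
    [hatB2] solve the equation that it gives. *)
Lemma curv0_hatB1 : comm A0 (E2 K) + comm (diag3 0 t.1 t.2) (hatB1 t A0) = 0.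
Proof. by flat_entries. Qed.

Lemma curv0_hatB2 : comm A0 (E3 K) + comm (diag3 0 t.1 t.2) (hatB2 t A0) = 0.
Proof. by flat_entries. Qed.

End FlowIsFlat.

End Flow.

(** * The zero curvature equation without its gauge *)

Section TangentMatrices.
Context {K : numClosedFieldType} {V : normedModType K}.

Lemma is_derive_mat3 (a b c a' b' c' a'' b'' c'' : V -> K) (t w : V)
    (da db dc da' db' dc' da'' db'' dc'' : K) :
  is_derive t w a da -> is_derive t w b db -> is_derive t w c dc ->
  is_derive t w a' da' -> is_derive t w b' db' -> is_derive t w c' dc' ->
  is_derive t w a'' da'' -> is_derive t w b'' db'' -> is_derive t w c'' dc'' ->
  is_derive_entries (fun s => mat3 (a s) (b s) (c s) (a' s) (b' s) (c' s)
    (a'' s) (b'' s) (c'' s)) t w (mat3 da db dc da' db' dc' da'' db'' dc'').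
Proof.
move=> ? ? ? ? ? ? ? ? ? i j; rewrite mxE; under eq_fun do rewrite mxE.
by case: (ord3P i) => ->; case: (ord3P j) => ->.
Qed.

Lemma is_derive_diag3 (a b c : V -> K) (t w : V) (da db dc : K) :
  is_derive t w a da -> is_derive t w b db -> is_derive t w c dc ->
  is_derive_entries (fun s => diag3 (a s) (b s) (c s)) t w (diag3 da db dc).
Proof.
move=> ad bd cd; rewrite diag3E; under eq_fun do rewrite diag3E.
by apply: is_derive_mat3 => //; exact: is_derive_cst.
Qed.

Variables (th1 th2 th3 : K) (q1 p1 q2 p2 : V -> K) (t w : V) (X : velocity K).
Hypotheses (q1d : is_derive t w q1 (vq1 X)) (p1d : is_derive t w p1 (vp1 X))
  (q2d : is_derive t w q2 (vq2 X)) (p2d : is_derive t w p2 (vp2 X)).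

Lemma is_derive_hatAm1 : is_derive_entries (fun s => hatAm1 (p1 s) (p2 s)) t w
  (dhatAm1 (p1 t) (p2 t) X).
Proof.
rewrite /dhatAm1 !row3_mulE mat3D.
under eq_fun do rewrite /hatAm1 row3_mulE.
apply: is_derive_mat3; derive_scalar; ring.
Qed.

Lemma is_derive_hatA0 :
  is_derive_entries (fun s => hatA0 th1 th2 th3 (q1 s) (p1 s) (q2 s) (p2 s)) t w
    (dhatA0 th1 th2 th3 (q1 t) (p1 t) (q2 t) (p2 t) X).
Proof. by apply: is_derive_mat3; derive_scalar; ring. Qed.

End TangentMatrices.

Section ZeroCurvature.
Context {K : numClosedFieldType}.
Variables (th1 th2 th3 : K) (q1 p1 q2 p2 u v : K * K -> K) (t w : K * K).
Hypotheses (q1d : differentiable q1 t) (p1d : differentiable p1 t)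
  (q2d : differentiable q2 t) (p2d : differentiable p2 t)
  (ud : differentiable u t) (vd : differentiable v t)
  (ut0 : u t != 0) (vt0 : v t != 0).

Definition lax_velocity : velocity K :=
  Velocity ('D_w q1 t) ('D_w p1 t) ('D_w q2 t) ('D_w p2 t)
           ('D_w u t / u t) ('D_w v t / v t).

Let X := lax_velocity.
Let G := gauge u v t.
Let Om := dloggauge X.
Let E := diag3 0 w.1 w.2.
Let T := diag3 0 t.1 t.2.
Let Am1 := hatAm1 (p1 t) (p2 t).
Let A0t := hatA0 th1 th2 th3 (q1 t) (p1 t) (q2 t) (p2 t).

Let G_unit : G \in unitmx. Proof. exact: diag3_unit. Qed.

Lemma near_neq0 (f : K * K -> K) :
  differentiable f t -> f t != 0 -> \forall s \near t, f s != 0.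
Proof.
move=> fd ft0; have fc := differentiable_continuous fd.
exact: (cvgr_neq0 _ fc ft0).
Qed.

(** Derivative of a conjugate: (G^-1 N G)' = G^-1 (N' + [N, G' G^-1]) G. *)
Lemma is_derive_laxA x :
  is_derive t w (laxA th1 th2 th3 q1 p1 q2 p2 u v x)
   (invmx G *m ((x ^+ 2)^-1 *: (dhatAm1 (p1 t) (p2 t) X + comm Am1 Om)
               + x^-1 *: (dhatA0 th1 th2 th3 (q1 t) (p1 t) (q2 t) (p2 t) X
                          + comm A0t Om)) *m G + E).
Proof.
(* [invmx] inverts the gauge only where u and v do not vanish, which holds near t;
   elsewhere the explicit inverse [Gi] may differ from it. *)
pose Gi s := diag3 1 (u s)^-1 (v s)^-1.
pose N s := (x ^+ 2)^-1 *: hatAm1 (p1 s) (p2 s)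
  + x^-1 *: hatA0 th1 th2 th3 (q1 s) (p1 s) (q2 s) (p2 s).
have AE : \near t, Gi t *m N t *m gauge u v t + diag3 0 t.1 t.2 =
    laxA th1 th2 th3 q1 p1 q2 p2 u v x t.
  near=> s; rewrite /laxA /gauge invmx_diag3//; near: s; exact: near_neq0.
have der (f : K * K -> K) : differentiable f t -> is_derive t w f ('D_w f t).
  by move=> fd; apply: derivableP; exact: diff_derivable.
have Gd : is_derive_entries (gauge u v) t w (G *m Om).
  rewrite [G *m Om]mul_diag3.
  apply: is_derive_diag3.
  - by apply: is_derive_eq (is_derive_cst_fun _ _ _) _; rewrite mulr0.
  - by apply: is_derive_eq (der _ ud) _ => /=; field.
  - by apply: is_derive_eq (der _ vd) _ => /=; field.
have Gid : is_derive_entries Gi t w (- (invmx G *m Om)).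
  rewrite [invmx G]invmx_diag3// mul_diag3 diag3N.
  apply: is_derive_diag3.
  - by apply: is_derive_eq (is_derive_cst_fun _ _ _) _; rewrite mulr0 oppr0.
  - by apply: is_derive_eq (is_deriveV_fun ut0 (der _ ud)) _ => /=; field.
  - by apply: is_derive_eq (is_deriveV_fun vt0 (der _ vd)) _ => /=; field.
have Nd : is_derive_entries N t w
    ((x ^+ 2)^-1 *: dhatAm1 (p1 t) (p2 t) X
     + x^-1 *: dhatA0 th1 th2 th3 (q1 t) (p1 t) (q2 t) (p2 t) X).
  apply: is_derive_entriesD; apply: is_derive_entriesZ.
  - by apply: is_derive_hatAm1; exact: der.
  - by apply: is_derive_hatA0; exact: der.
have Td : is_derive_entries (fun s : K * K => diag3 0 s.1 s.2) t w E.
  by apply: is_derive_diag3; exact: is_derive_affine.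
apply: (near_eq_is_derive AE); apply: is_derive_eq.
  apply: is_derive_mx; apply: is_derive_entriesD Td.
  exact: is_derive_entriesM (is_derive_entriesM Gid Nd) Gd.
have GiE : Gi t = invmx G by rewrite [invmx G]invmx_diag3.
rewrite GiE; congr (_ + _).
have -> : G *m Om = Om *m G by apply: subr0_eq; exact: diag3C.
rewrite mulmxA -mulmxDl; congr (_ *m _).
rewrite mulNmx -!mulmxA -mulmxN -!mulmxDr; congr (_ *m _).
rewrite /N /comm mulmxDl mulmxDr -!scalemxAl -!scalemxAr.
by apply/matrixP => i j; rewrite !mxE; ring.
Unshelve. all: by end_near. Qed.

Variable B : 'M[K]_3.
Hypothesis C0 : comm A0t E + comm T B = 0.

(** All diagonal matrices commute with the gauge, so the whole equation is a
    conjugate; the derivative of T cancels the term [E], and the hypothesis [C0]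
    removes the coefficient of x^0. *)
Lemma curvature_gauged x : x != 0 ->
  let Bx := x *: E + invmx G *m B *m G in
  let Ax := laxA th1 th2 th3 q1 p1 q2 p2 u v x in
  ('D_w Ax t - E + (Ax t *m Bx - Bx *m Ax t) == 0) =
  ((x ^+ 2)^-1 *: curv2 (p1 t) (p2 t) B X
   + x^-1 *: curv1 th1 th2 th3 (q1 t) (p1 t) (q2 t) (p2 t) E B X == 0).
Proof.
move=> x0 /=; rewrite (derive_val (is_derive := is_derive_laxA x)).
rewrite addrK -/(comm _ _).
set Ah := (x ^+ 2)^-1 *: Am1 + x^-1 *: A0t.
have -> : laxA th1 th2 th3 q1 p1 q2 p2 u v x t = invmx G *m (Ah + T) *m G.
  by rewrite mulmxDr mulmxDl (conj_commute G_unit (diag3C _ _ _ _ _ _)).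
have -> : x *: E + invmx G *m B *m G = invmx G *m (x *: E + B) *m G.
  rewrite mulmxDr mulmxDl -scalemxAr -scalemxAl.
  by rewrite (conj_commute G_unit (diag3C _ _ _ _ _ _)).
rewrite comm_conj// -mulmxDl -mulmxDr conj_eq0//; congr (_ == _).
rewrite -[RHS]addr0 -[in RHS]C0 /curv2 /curv1 /Ah.
rewrite !(commDl, commDr, commZl, commZr) diag3C -/Om -/Am1 -/A0t.
by apply/matrixP => i j; rewrite !mxE; field.
Qed.

(** At x = 1 and x = -1 the two coefficients have a vanishing sum and a vanishing
    difference. *)
Lemma zero_curvatureP :
  (forall x, x != 0 ->
    let Bx := x *: E + invmx G *m B *m G in
    let Ax := laxA th1 th2 th3 q1 p1 q2 p2 u v x in
    'D_w Ax t - E + (Ax t *m Bx - Bx *m Ax t) = 0) <->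
  (curv2 (p1 t) (p2 t) B X = 0 /\
   curv1 th1 th2 th3 (q1 t) (p1 t) (q2 t) (p2 t) E B X = 0).
Proof.
split=> [flat|[C2 C1] x x0]; last first.
  by apply/eqP; rewrite curvature_gauged// C2 C1 !scaler0 addr0.
have flat' x : x != 0 -> (x ^+ 2)^-1 *: curv2 (p1 t) (p2 t) B X
    + x^-1 *: curv1 th1 th2 th3 (q1 t) (p1 t) (q2 t) (p2 t) E B X = 0.
  by move=> x0; apply/eqP; rewrite -curvature_gauged//; apply/eqP/flat.
have := flat' 1 (oner_neq0 _); have := flat' (-1).
rewrite oppr_eq0 oner_neq0 sqrrN expr1n invrN invr1 scaleN1r !scale1r.
move=> /(_ isT)/subr0_eq <-; rewrite -mulr2n -scaler_nat => /eqP.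
by rewrite scaler_eq0 pnatr_eq0 /= => /eqP.
Qed.

End ZeroCurvature.

(** * Hamiltonian equations *)

Section HamiltonEquations.
Context {K : numClosedFieldType}.

Lemma derive1_val (f : K -> K) (x a : K) : is_derive x (1 : K) f a -> derive1 f x = a.
Proof. by move=> fa; rewrite derive1E derive_val. Qed.

Lemma derive1_affine_mx (M N : 'M[K]_3) x :
  derive1 (fun y : K => y *: M + N) x = M.
Proof.
rewrite derive1E; apply: derive_val; apply: is_derive_mx => i j.
under eq_fun do rewrite !mxE.
by derive_scalar; ring.
Qed.

Variables (th1 th2 th3 : K) (t : K * K) (q1 p1 q2 p2 : K).
Hypotheses (t1n0 : t.1 != 0) (t2n0 : t.2 != 0) (t12n0 : t.1 - t.2 != 0).

Let t21n0 : t.2 - t.1 != 0. Proof. by rewrite -opprB oppr_eq0. Qed.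

Ltac hamiltonian_derivative :=
  rewrite ?opprK; apply: derive1_val; rewrite /H1 /H2 /H_III_D6 /=;
  derive_scalar; rewrite /dH_own_p /dH_own_q /dH_other_p /dH_other_q; field;
  rewrite ?t1n0 ?t2n0 ?t12n0 ?t21n0 //.

Lemma H1_derivatives (X := flow1 th1 th2 th3 t q1 p1 q2 p2) :
  [/\ derive1 (fun p => H1 th1 th2 th3 t q1 p q2 p2) p1 = vq1 X,
      derive1 (fun p => H1 th1 th2 th3 t q1 p1 q2 p) p2 = vq2 X,
      derive1 (fun q => H1 th1 th2 th3 t q p1 q2 p2) q1 = - vp1 X &
      derive1 (fun q => H1 th1 th2 th3 t q1 p1 q p2) q2 = - vp2 X].
Proof. by rewrite {}/X; split => /=; hamiltonian_derivative. Qed.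

Lemma H2_derivatives (X := flow2 th1 th2 th3 t q1 p1 q2 p2) :
  [/\ derive1 (fun p => H2 th1 th2 th3 t q1 p q2 p2) p1 = vq1 X,
      derive1 (fun p => H2 th1 th2 th3 t q1 p1 q2 p) p2 = vq2 X,
      derive1 (fun q => H2 th1 th2 th3 t q p1 q2 p2) q1 = - vp1 X &
      derive1 (fun q => H2 th1 th2 th3 t q1 p1 q p2) q2 = - vp2 X].
Proof. by rewrite {}/X; split => /=; hamiltonian_derivative. Qed.

End HamiltonEquations.

Section Equivalence.
Context {K : numClosedFieldType}.
Variables (th1 th2 th3 : K) (q1 p1 q2 p2 u v : K * K -> K) (t : K * K).
Hypotheses (t1n0 : t.1 != 0) (t2n0 : t.2 != 0) (t12n0 : t.1 - t.2 != 0).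
Hypotheses (q1d : differentiable q1 t) (p1d : differentiable p1 t)
  (q2d : differentiable q2 t) (p2d : differentiable p2 t)
  (ud : differentiable u t) (vd : differentiable v t)
  (ut0 : u t != 0) (vt0 : v t != 0).

Let t21n0 : t.2 - t.1 != 0. Proof. by rewrite -opprB oppr_eq0. Qed.

Lemma logarithmic_eq (c f df y : K) : c != 0 -> f != 0 ->
  c * f^-1 * df = y <-> df / f = y / c.
Proof.
move=> c0 f0; split=> [<-|e]; first by field; rewrite c0 f0.
by rewrite -mulrA [f^-1 * df]mulrC e; field.
Qed.

Lemma velocity_eq_flow1 :
  lax_velocity q1 p1 q2 p2 u v t (1, 0)
    = flow1 th1 th2 th3 t (q1 t) (p1 t) (q2 t) (p2 t)
  <-> hamilton_eqs (@partial1 _ _) (H1 th1 th2 th3) q1 p1 q2 p2 t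
      /\ gauge_eqs1 th2 th3 q1 p1 q2 p2 u v t.
Proof.
rewrite /hamilton_eqs /gauge_eqs1 /partial1.
have [-> -> -> ->] :=
  H1_derivatives th1 th2 th3 (q1 t) (p1 t) (q2 t) (p2 t) t1n0 t12n0.
rewrite !opprK !logarithmic_eq ?mulf_neq0//.
split=> [[-> -> -> -> -> ->]//|[[? ? ? ?] [? ?]]].
by congr Velocity.
Qed.

Lemma velocity_eq_flow2 :
  lax_velocity q1 p1 q2 p2 u v t (0, 1)
    = flow2 th1 th2 th3 t (q1 t) (p1 t) (q2 t) (p2 t)
  <-> hamilton_eqs (@partial2 _ _) (H2 th1 th2 th3) q1 p1 q2 p2 t
      /\ gauge_eqs2 th2 th3 q1 p1 q2 p2 u v t.
Proof.
rewrite /hamilton_eqs /gauge_eqs2 /partial2 [t.2 * q1 t + _]addrC.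
have [-> -> -> ->] :=
  H2_derivatives th1 th2 th3 (q1 t) (p1 t) (q2 t) (p2 t) t2n0 t12n0.
rewrite !opprK !logarithmic_eq ?mulf_neq0//.
split=> [[-> -> -> -> -> ->]//|[[? ? ? ?] [? ?]]].
by congr Velocity.
Qed.

Lemma compatible1P :
  (forall x, x != 0 -> compatible1 th1 th2 th3 q1 p1 q2 p2 u v x t)
  <-> hamilton_eqs (@partial1 _ _) (H1 th1 th2 th3) q1 p1 q2 p2 t
      /\ gauge_eqs1 th2 th3 q1 p1 q2 p2 u v t.
Proof.
have flat := zero_curvatureP (w := (1, 0)) q1d p1d q2d p2d ud vd ut0 vt0
  (curv0_hatB1 th1 th2 th3 (q1 t) (p1 t) (q2 t) (p2 t) t1n0 t12n0).
apply: iff_trans _ velocity_eq_flow1.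
apply: iff_trans _ (curv_flow1P _ _ _ _ _ _ _ t1n0 t12n0 _).
apply: iff_trans _ flat.
by split=> compat x x0; have := compat x x0;
  rewrite /compatible1 derive1_affine_mx.
Qed.

Lemma compatible2P :
  (forall x, x != 0 -> compatible2 th1 th2 th3 q1 p1 q2 p2 u v x t)
  <-> hamilton_eqs (@partial2 _ _) (H2 th1 th2 th3) q1 p1 q2 p2 t
      /\ gauge_eqs2 th2 th3 q1 p1 q2 p2 u v t.
Proof.
have flat := zero_curvatureP (w := (0, 1)) q1d p1d q2d p2d ud vd ut0 vt0
  (curv0_hatB2 th1 th2 th3 (q1 t) (p1 t) (q2 t) (p2 t) t2n0 t12n0).
apply: iff_trans _ velocity_eq_flow2.
apply: iff_trans _ (curv_flow2P _ _ _ _ _ _ _ t2n0 t12n0 _).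
apply: iff_trans _ flat.
by split=> compat x x0; have := compat x x0;
  rewrite /compatible2 derive1_affine_mx.
Qed.

End Equivalence.

Lemma times_neq0 (K : idomainType) (t : K * K) : t.1 * t.2 * (t.1 - t.2) != 0 ->
  [/\ t.1 != 0, t.2 != 0 & t.1 - t.2 != 0].
Proof. by rewrite !mulf_eq0 !negb_or => /andP[/andP[]]. Qed.

Unset Implicit Arguments.

Theorem mainTheorem13 (R : realType) (th0 th1 th2 th3 : R[i])
    (hth : th0 + th1 + th2 + th3 = 0)
    (D : set (R[i] * R[i])) (hD : is_domain D)
    (hsing : forall t, D t -> t.1 * t.2 * (t.1 - t.2) != 0)
    (q1 p1 q2 p2 u v : R[i] * R[i] -> R[i])
    (hq1 : holomorphic_on D q1) (hp1 : holomorphic_on D p1)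
    (hq2 : holomorphic_on D q2) (hp2 : holomorphic_on D p2)
    (hu : holomorphic_on D u) (hv : holomorphic_on D v)
    (hu0 : forall t, D t -> u t != 0) (hv0 : forall t, D t -> v t != 0) :
  (forall t, D t -> forall x : R[i], x != 0 ->
     compatible1 th1 th2 th3 q1 p1 q2 p2 u v x t /\
     compatible2 th1 th2 th3 q1 p1 q2 p2 u v x t)
  <->
  (forall t, D t ->
     [/\ hamilton_eqs (@partial1 _ _) (H1 th1 th2 th3) q1 p1 q2 p2 t,
         hamilton_eqs (@partial2 _ _) (H2 th1 th2 th3) q1 p1 q2 p2 t,
         gauge_eqs1 th2 th3 q1 p1 q2 p2 u v t &
         gauge_eqs2 th2 th3 q1 p1 q2 p2 u v t]).
Proof.
have pointwise t (Dt : D t) :=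
  let: And3 t1n0 t2n0 t12n0 := times_neq0 (hsing t Dt) in
  (compatible1P th1 th2 th3 t1n0 t12n0 (hq1 t Dt) (hp1 t Dt) (hq2 t Dt)
     (hp2 t Dt) (hu t Dt) (hv t Dt) (hu0 t Dt) (hv0 t Dt),
   compatible2P th1 th2 th3 t2n0 t12n0 (hq1 t Dt) (hp1 t Dt) (hq2 t Dt)
     (hp2 t Dt) (hu t Dt) (hv t Dt) (hu0 t Dt) (hv0 t Dt)).
split=> [compat t Dt|flow t Dt x x0]; have [iff1 iff2] := pointwise t Dt.
  have [//|ham1 gauge1] := iff1.1; first by move=> x /(compat t Dt)[].
  have [//|ham2 gauge2] := iff2.1; first by move=> x /(compat t Dt)[].
  by split.
have [ham1 ham2 gauge1 gauge2] := flow t Dt.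
by split; [exact: iff1.2 | exact: iff2.2].
Qed.
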